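(* Let $K_{3,3}$ be the complete bipartite graph with vertex groups $\{1,2,3\}$ and $\{4,5,6\}$, and let $d_v=2$ for all six vertices. Then the global Markov ideal $I_{\mathrm{gl}(K_{3,3})}\subseteq\Bbbk[p_x:x\in[2]^6]$ ($\Bbbk$ a field) is not radical.
   Context: $[2]=\{1,2\}$; for $x\in[2]^6$ and $W\subseteq\{1,\dots,6\}$ write $x_W=(x_v)_{v\in W}$. For a graph $G$ on the vertex set $V=\{1,\dots,6\}$ with binary nodes, the global Markov ideal $I_{\mathrm{gl}(G)}$ is the ideal of $\Bbbk[p_x:x\in[2]^6]$ generated by all binomials $p_{x_Ax_Bx_C}p_{x'_Ax'_Bx_C}-p_{x_Ax'_Bx_C}p_{x'_Ax_Bx_C}$, where $A,B,C$ range over all partitions $V=A\cup B\cup C$ into disjoint (possibly empty) sets such that every path in $G$ from a vertex of $A$ to a vertex of $B$ meets $C$, and $x_A,x_A'\in[2]^A$, $x_B,x_B'\in[2]^B$, $x_C\in[2]^C$. *)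

(* Defs.v *)
From mathcomp Require Import all_boot all_algebra.
From mathcomp Require Import mpoly.

Set Implicit Arguments.
Unset Strict Implicit.
Unset Printing Implicit Defensive.

Import GRing.Theory.
Local Open Scope ring_scope.

Section Ideals.
Variable R : comNzRingType.

(* Ideals are Prop-valued, since membership in a generated ideal need not be
   decidable; each pair in s is (coefficient, generator). *)
Definition ideal_gen (G : R -> Prop) (f : R) : Prop :=
  exists s : seq (R * R),
    (forall cg, cg \in s -> G cg.2) /\ f = \sum_(cg <- s) cg.1 * cg.2.

Definition radical (I : R -> Prop) (f : R) : Prop :=
  exists n : nat, (0 < n)%N /\ I (f ^+ n).

Definition is_radical (I : R -> Prop) : Prop :=
  forall f, radical I f <-> I f.

End Ideals.

Section GlobalMarkov.
Variables (T : finType) (e : rel T).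

(* Paths have pairwise distinct vertices and may consist of a single vertex. *)
Definition separated (A B C : {set T}) : Prop :=
  forall (a : T) (s : seq T),
    path e a s -> uniq (a :: s) -> a \in A -> last a s \in B ->
    exists2 c, c \in a :: s & c \in C.

Definition partition3 (A B C : {set T}) : Prop :=
  [/\ [disjoint A & B], [disjoint A & C], [disjoint B & C]
    & A :|: B :|: C = [set: T]].

(* The joint states of binary nodes: 'I_2 stands for [2]. *)
Definition state : finType := {ffun T -> 'I_2}.

(* The state x_A x_B x_C of a partition A, B, C.  A partial state on W is
   represented by any total state extending it: only the values of xA on A,
   of xB on B and of xC on C are used. *)
Definition glue (A B : {set T}) (xA xB xC : state) : state :=
  [ffun v => if v \in A then xA v else if v \in B then xB v else xC v].

Variable k : fieldType.

(* The polynomial ring with one indeterminate for each joint state; mpoly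
   numbers its indeterminates, so states are numbered by enum_rank. *)
Local Notation state_poly := {mpoly k[#|state|]}.

Definition p_ (x : state) : state_poly := 'X_(enum_rank x).

Definition global_markov_gen (f : state_poly) : Prop :=
  exists A B C : {set T},
    [/\ partition3 A B C, separated A B C
      & exists xA xA' xB xB' xC : state,
          f = p_ (glue A B xA xB xC) * p_ (glue A B xA' xB' xC)
            - p_ (glue A B xA xB' xC) * p_ (glue A B xA' xB xC)].

Definition global_markov_ideal : state_poly -> Prop :=
  ideal_gen global_markov_gen.

End GlobalMarkov.

Arguments global_markov_ideal {T} e k f.

(* The vertices 1, ..., 6 are numbered from 0, so the two groups are
   {0, 1, 2} and {3, 4, 5}. *)
Definition K33 : rel 'I_6 := fun u v => (u < 3)%N != (v < 3)%N.

(* Main.v *)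
Require Import Defs.
From mathcomp Require Import all_boot all_algebra.
From mathcomp Require Import mpoly.

(* A binomial of the ideal of the shape p_a p_b - p_c p_d arises from two states
   a, b that agree on one vertex group, by exchanging some of their values on the
   other group.  So a difference of two monomials lies in the ideal when a chain of
   such exchanges joins them, and a class of monomials closed under exchanges gives
   a linear form vanishing on the ideal: the sum of the coefficients over the class.
   Write p_xy with x and y the octal digits of the states of the two groups, and let
     u = p_00 p_16 p_25 p_43 p_70,    v = p_00 p_07 p_34 p_52 p_61.
   The class of u has seven elements, and v is not one of them, so u - v is not in
   the ideal.  But ten exchanges turn p_00 u into p_00 v, and since p_00 divides
   u - v, the ideal contains (u - v)^2. *)

Set Implicit Arguments.
Unset Strict Implicit.
Unset Printing Implicit Defensive.

Import GRing.Theory.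
Local Open Scope ring_scope.

(** * Generated ideals and linear forms vanishing on them *)

Section IdealGen.
Variables (R : comNzRingType) (G : R -> Prop).

Lemma ideal_gen0 : ideal_gen G 0.
Proof. by exists [::]; split=> //; rewrite big_nil. Qed.

Lemma ideal_genD f g : ideal_gen G f -> ideal_gen G g -> ideal_gen G (f + g).
Proof.
move=> [s [sG ->]] [t [tG ->]]; exists (s ++ t); split; last by rewrite big_cat.
by move=> cg; rewrite mem_cat => /orP[/sG|/tG].
Qed.

Lemma ideal_genMl h f : ideal_gen G f -> ideal_gen G (h * f).
Proof.
move=> [s [sG ->]]; exists [seq (h * cg.1, cg.2) | cg <- s]; split.
  by move=> _ /mapP[cg /sG Gcg ->].
by rewrite big_map mulr_sumr; apply: eq_bigr => cg _; rewrite mulrA.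
Qed.

Lemma ideal_gen_in g : G g -> ideal_gen G g.
Proof.
move=> Gg; exists [:: (1, g)]; split; last by rewrite big_seq1 mul1r.
by move=> cg; rewrite inE => /eqP ->.
Qed.

End IdealGen.

(** [undup] counts each monomial once, so that the form is 0 or 1 on monomials. *)
Definition coef_sum n (k : fieldType) (S : seq 'X_{1..n}) (f : {mpoly k[n]}) : k :=
  \sum_(m <- undup S) f@_m.

Lemma coef_sumB n (k : fieldType) (S : seq 'X_{1..n}) (f g : {mpoly k[n]}) :
  coef_sum S (f - g) = coef_sum S f - coef_sum S g.
Proof. by rewrite /coef_sum -sumrB; apply: eq_bigr => m _; rewrite mcoeffB. Qed.

Lemma coef_sumX n (k : fieldType) (S : seq 'X_{1..n}) m :
  coef_sum S 'X_[k, m] = (m \in S)%:R.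
Proof.
rewrite /coef_sum; under eq_bigr do rewrite mcoeffX.
rewrite -mem_undup; have := undup_uniq S; elim: (undup S) => [|m' s IHs] /=.
  by rewrite big_nil.
case/andP=> m's /IHs {}IHs; rewrite big_cons IHs inE.
by case: eqP => [->|_]; rewrite ?add0r // (negPf m's) addr0.
Qed.

(** [coef_sum S] is linear, and expanding the coefficients into monomials reduces the claim to
    monomial multiples of generators. *)
Lemma coef_sum_ideal_gen n (k : fieldType) (S : seq 'X_{1..n})
    (G : {mpoly k[n]} -> Prop) f :
  (forall m g, G g -> coef_sum S ('X_[m] * g) = 0) ->
  ideal_gen G f -> coef_sum S f = 0.
Proof.
move=> SG [s [sG ->]]; rewrite /coef_sum.
under eq_bigr do rewrite raddf_sum.
rewrite exchange_big /= big_seq big1 // => cg /sG Gcg.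
rewrite [cg.1]mpolyE mulr_suml.
under eq_bigr do rewrite raddf_sum.
rewrite exchange_big /= big1 // => m _.
under eq_bigr do rewrite -scalerAl mcoeffZ.
by rewrite -mulr_sumr [X in _ * X]SG ?mulr0.
Qed.

(** * States encoded by bits, and exchanges between them *)

(* The state of one vertex group; unlike finite functions, codes compute. *)
Definition half : eqType := (bool * bool * bool)%type.
Definition code : eqType := (half * half)%type.

Definition bit (c : code) (v : nat) : bool :=
  nth false [:: c.1.1.1; c.1.1.2; c.1.2; c.2.1.1; c.2.1.2; c.2.2] v.

Definition decode (c : code) : state 'I_6 :=
  [ffun v : 'I_6 => if bit c v then 1 else 0].

Definition tabulate (P : 'I_6 -> bool) : code :=
  ((P (inord 0), P (inord 1), P (inord 2)), (P (inord 3), P (inord 4), P (inord 5))).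

Definition encode (x : state 'I_6) : code := tabulate (fun v => x v == 1).

Lemma bit_tabulate P (v : 'I_6) : bit (tabulate P) v = P v.
Proof.
by case: v => [[|[|[|[|[|[|]]]]]] lt_v6] //=; rewrite /bit /=;
   congr P; apply: val_inj; rewrite /= inordK.
Qed.

Lemma tabulate_bit c : tabulate (fun v => bit c v) = c.
Proof. by case: c => [[[? ?] ?] [[? ?] ?]]; rewrite /tabulate !inordK. Qed.

Lemma eq_tabulate P Q : P =1 Q -> tabulate P = tabulate Q.
Proof. by move=> eqPQ; rewrite /tabulate !eqPQ. Qed.

Lemma encodeK : cancel encode decode.
Proof.
move=> x; apply/ffunP=> v; rewrite ffunE bit_tabulate.
by case: eqP => [->//|]; case: (x v) => [[|[|]] //= lt_i2] ne; [|case: ne]; apply: val_inj.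
Qed.

Lemma decodeK : cancel decode encode.
Proof.
move=> c; rewrite -[RHS]tabulate_bit; apply: eq_tabulate => v.
by rewrite ffunE; case: bit.
Qed.

(** The mask [w] marks the places to exchange; [mix w x y] and [mix w y x] are the two results. *)
Definition mix (w x y : half) : half :=
  ((if w.1.1 then y.1.1 else x.1.1, if w.1.2 then y.1.2 else x.1.2),
   if w.2 then y.2 else x.2).

Lemma mixK w x y : mix w (mix w x y) (mix w y x) = x.
Proof. by move: w x y => [[[] []] []] [[? ?] ?] [[? ?] ?]. Qed.

Definition halves : seq half :=
  [seq (ij, l) | ij <- [seq (i, j) | i <- [:: false; true], j <- [:: false; true]],
                 l <- [:: false; true]].

Lemma mem_halves w : w \in halves.
Proof. by move: w => [[[] []] []]. Qed.

Definition swaps (a b : code) : seq (code * code) :=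
  (if a.2 == b.2 then
     [seq ((mix w a.1 b.1, a.2), (mix w b.1 a.1, b.2)) | w <- halves] else [::]) ++
  (if a.1 == b.1 then
     [seq ((a.1, mix w a.2 b.2), (b.1, mix w b.2 a.2)) | w <- halves] else [::]).

Lemma swapsP a b c d : reflect
  ((a.2 = b.2 /\ exists w, c = (mix w a.1 b.1, a.2) /\ d = (mix w b.1 a.1, b.2)) \/
   (a.1 = b.1 /\ exists w, c = (a.1, mix w a.2 b.2) /\ d = (b.1, mix w b.2 a.2)))
  ((c, d) \in swaps a b).
Proof.
rewrite /swaps mem_cat; apply: (iffP orP) => -[].
- by case: eqP => // e /mapP[w _ [-> ->]]; left; split=> //; exists w.
- by case: eqP => // e /mapP[w _ [-> ->]]; right; split=> //; exists w.
- by case=> -> [w [-> ->]]; left; rewrite eqxx; apply/mapP; exists w; rewrite ?mem_halves.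
- by case=> -> [w [-> ->]]; right; rewrite eqxx; apply/mapP; exists w; rewrite ?mem_halves.
Qed.

Lemma swaps_sym a b c d : (c, d) \in swaps a b -> (a, b) \in swaps c d.
Proof.
move: a b => [a1 a2] [b1 b2] /swapsP /= H; apply/swapsP.
by case: H => -[-> [w [-> ->]]]; [left | right]; split=> //=;
   exists w; rewrite !mixK.
Qed.

(** * Separation in $K_{3,3}$ and the generators of the ideal *)

(** Members of [A] and [B] in different groups would be joined by an edge avoiding [C]. So [A] and
    [B], both nonempty, lie in one group, and only [C] is left for the other. *)
Lemma K33_separatedP (A B C : {set 'I_6}) (u v : 'I_6) :
  partition3 A B C -> separated K33 A B C -> u \in A -> v \in B ->
  forall z : 'I_6, (z < 3)%N != (u < 3)%N -> z \in C.
Proof.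
move=> [dAB dAC dBC cov] sep uA vB.
have same (x y : 'I_6) : x \in A -> y \in B -> (x < 3)%N = (y < 3)%N.
  move=> xA yB; have [//|ne] := eqVneq (x < 3)%N (y < 3)%N.
  have neq : x != y by apply: contraNneq ne => ->.
  have [||//|//|c] := sep x [:: y]; rewrite /= ?/K33 ?ne ?inE ?neq //.
  by case/orP=> /eqP ->; rewrite ?(disjointFr dAC xA) ?(disjointFr dBC yB).
move=> z ne; have: z \in A :|: B :|: C by rewrite cov inE.
rewrite !inE -orbA => /or3P[zA|zB|//].
  by rewrite (same _ _ zA vB) (same _ _ uA vB) eqxx in ne.
by rewrite -(same _ _ uA zB) eqxx in ne.
Qed.

(** The first edge of a path from [A] already leads into [C]. *)
Lemma K33_separated (s : bool) (A B C : {set 'I_6}) :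
  [disjoint A & B] -> (forall v, v \in A -> (v < 3)%N = s) ->
  (forall v : 'I_6, (v < 3)%N != s -> v \in C) -> separated K33 A B C.
Proof.
move=> dAB As Cs u [|v t] /=; first by move=> _ _ uA; rewrite (disjointFr dAB uA).
case/andP=> uv _ _ /As us _; exists v; first by rewrite !inE eqxx orbT.
by apply: Cs; rewrite -us eq_sym.
Qed.


(* The effect on two states of exchanging their values at the vertices of P that
   lie in one of the two groups, which is {0, 1, 2} if s and {3, 4, 5} if not. *)
Definition exchange (s : bool) (P : pred 'I_6) (a b : state 'I_6) : state 'I_6 :=
  [ffun v : 'I_6 => if ((v < 3)%N == s) && P v then b v else a v].

Section Generators.
Variable k : fieldType.

(** If [A] or [B] is empty, the binomial is zero. Otherwise both lie in one group, the two glued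
    states agree on the other, and their values on [B] are exchanged. *)
Lemma global_markov_gen_K33 (f : {mpoly k[#|state 'I_6|]}) :
  global_markov_gen K33 f <->
  exists (s : bool) (P : pred 'I_6) (a b : state 'I_6),
    (forall v : 'I_6, (v < 3)%N != s -> a v = b v)
    /\ f = p_ k a * p_ k b - p_ k (exchange s P a b) * p_ k (exchange s P b a).
Proof.
split=> [[A [B [C [part sep [xA [xA' [xB [xB' [xC ->]]]]]]]]]|[s [P [a [b [eqab ->]]]]]].
  have [dAB dAC dBC _] := part.
  have degenerate (x y : state 'I_6) :
      exists (s : bool) (P : pred 'I_6) (a b : state 'I_6),
        (forall v : 'I_6, (v < 3)%N != s -> a v = b v)
        /\ p_ k x * p_ k y - p_ k y * p_ k x
           = p_ k a * p_ k b - p_ k (exchange s P a b) * p_ k (exchange s P b a).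
    (* Zero arises from the empty exchange between a state and itself. *)
    exists true, pred0, x, x; split=> //.
    rewrite [X in X - _]mulrC subrr (_ : exchange _ _ _ _ = x) ?subrr //.
    by apply/ffunP=> v; rewrite ffunE andbF.
  have [A0|[u uA]] := set_0Vmem A.
    have glueA0 x y z : glue A B x y z = glue A B xA y z.
      by apply/ffunP=> v; rewrite !ffunE A0 inE.
    by rewrite (glueA0 xA' xB') (glueA0 xA' xB).
  have [B0|[w wB]] := set_0Vmem B.
    have glueB0 x y z : glue A B x y z = glue A B x xB z.
      by apply/ffunP=> v; rewrite !ffunE B0 !inE.
    by rewrite (glueB0 _ xB') (glueB0 _ xB') [X in _ - X]mulrC.
  have memC := K33_separatedP part sep uA wB.
  exists (u < 3)%N, (mem B), (glue A B xA xB xC), (glue A B xA' xB' xC); split.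
    by move=> v /memC vC; rewrite !ffunE !(disjointFl dAC vC, disjointFl dBC vC).
  have glueE x x' y y' : glue A B x y' xC =
      exchange (u < 3)%N (mem B) (glue A B x y xC) (glue A B x' y' xC).
    apply/ffunP=> v; rewrite !ffunE /=; case: ifP => vA.
      by rewrite (disjointFr dAB vA) andbF.
    case: ifP => vB; last by rewrite andbF.
    rewrite andbT; case: eqP => // /eqP /memC vC.
    by rewrite (disjointFr dBC vB) in vC.
  by rewrite -!glueE.
(* [B] is the exchanged part of group [s], [A] the rest of it, and [C] the other group. *)
exists [set v : 'I_6 | ((v < 3)%N == s) && ~~ P v],
       [set v : 'I_6 | ((v < 3)%N == s) && P v],
       [set v : 'I_6 | (v < 3)%N != s]; split.
- split; do ?by rewrite -setI_eq0; apply/eqP/setP=> v; rewrite !inE; case: eqP; case: (P v).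
  by apply/setP=> v; rewrite !inE; case: eqP; case: (P v).
- apply: (@K33_separated s).
  + by rewrite -setI_eq0; apply/eqP/setP=> v; rewrite !inE; case: eqP; case: (P v).
  + by move=> v; rewrite inE => /andP[/eqP].
  + by move=> v; rewrite inE.
- exists a, b, a, b, a.
  congr (p_ _ _ * p_ _ _ - p_ _ _ * p_ _ _); apply/ffunP=> v; rewrite !ffunE ?inE;
    have := eqab v; case: eqP => //= _; case: (P v) => //= /(_ isT) //.
Qed.

Lemma swap_global_markov_gen a b c d : (c, d) \in swaps a b ->
  global_markov_gen K33
    (p_ k (decode a) * p_ k (decode b) - p_ k (decode c) * p_ k (decode d)).
Proof.
move: a b => [a1 a2] [b1 b2] /swapsP /= sw; apply/global_markov_gen_K33.
case: sw => -[e [w [-> ->]]];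
  (* The mask is repeated on both halves; [exchange] restricts it to the group chosen. *)
  [exists true, (bit (w, w)) | exists false, (bit (w, w))];
  exists (decode (a1, a2)), (decode (b1, b2));
  (split; last congr (_ - p_ _ _ * p_ _ _); first move=> v; last 2 first);
  do ?apply/ffunP=> v; rewrite !ffunE ?e;
  by case: v => [[|[|[|[|[|[|]]]]]] lt_v6] //=;
     rewrite /bit /mix /=; case: w => [[[] []] []].
Qed.

Lemma swap_of_global_markov_gen f : global_markov_gen K33 f ->
  exists a b c d, (c, d) \in swaps a b /\
    f = p_ k (decode a) * p_ k (decode b) - p_ k (decode c) * p_ k (decode d).
Proof.
case/global_markov_gen_K33=> s [P [a [b [eqab ->]]]].
exists (encode a), (encode b), (encode (exchange s P a b)), (encode (exchange s P b a)).
split; last by rewrite !encodeK.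
apply/swapsP; case: s eqab => eqab; [left | right]; rewrite /encode /tabulate /=.
- split; first by rewrite !(eqab (inord _)) ?inordK.
  exists (tabulate P).1.
  by rewrite /mix /= !ffunE !inordK //=; do 3 case: (P _).
- split; first by rewrite !(eqab (inord _)) ?inordK.
  exists (tabulate P).2.
  by rewrite /mix /= !ffunE !inordK //=; do 3 case: (P _).
Qed.

End Generators.

(** * Monomials as lists of codes, and moves between them *)

(** Lists up to permutation represent monomials faithfully and can be compared by computation. *)
Definition mnm_of (t : seq code) : 'X_{1..#|state 'I_6|} :=
  (\sum_(c <- t) U_(enum_rank (decode c)))%MM.

Lemma mnm_of_cons c t : mnm_of (c :: t) = (U_(enum_rank (decode c)) + mnm_of t)%MM.
Proof. by rewrite /mnm_of big_cons. Qed.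

Lemma mnm_ofE t c : mnm_of t (enum_rank (decode c)) = count_mem c t.
Proof.
elim: t => [|c' t IHt]; first by rewrite /mnm_of big_nil mnm0E.
rewrite mnm_of_cons mnmDE mnm1E IHt /=; congr (nat_of_bool _ + _)%N.
by rewrite (inj_eq enum_rank_inj) (inj_eq (can_inj decodeK)).
Qed.

Lemma eq_mnm_of s t : perm_eq s t -> mnm_of s = mnm_of t.
Proof. by move=> st; apply: perm_big. Qed.

Lemma mnm_of_perm s t : mnm_of s = mnm_of t -> perm_eq s t.
Proof. by move=> st; apply/allP=> c _ /=; rewrite -!mnm_ofE st. Qed.

Lemma mnm_of_rem m c t : (m + U_(enum_rank (decode c)))%MM = mnm_of t ->
  c \in t /\ m = mnm_of (rem c t).
Proof.
move=> def_t; have tc : c \in t.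
  by rewrite -has_pred1 has_count -mnm_ofE -def_t mnmDE mnm1E eqxx addn1.
split=> //; apply: (@addIm _ U_(enum_rank (decode c))%MM).
by rewrite def_t (eq_mnm_of (perm_to_rem tc)) mnm_of_cons addmC.
Qed.

(** Taking [b] from [rem a t] selects two different factors, possibly with equal codes. *)
Definition moves (t : seq code) : seq (seq code) :=
  [seq cd.1 :: cd.2 :: rem ab.2 (rem ab.1 t) |
     ab <- [seq (a, b) | a <- t, b <- rem a t], cd <- swaps ab.1 ab.2].

Lemma movesP t t' : reflect
  (exists a b c d, [/\ a \in t, b \in rem a t, (c, d) \in swaps a b
     & t' = c :: d :: rem b (rem a t)])
  (t' \in moves t).
Proof.
apply: (iffP allpairsPdep) => [[ab [[c d] [/allpairsPdep[a [b [ta tb ->]]] /= cd ->]]]|].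
  by exists a, b, c, d.
move=> [a [b [c [d [ta tb cd ->]]]]]; exists (a, b), (c, d); split=> //.
by apply/allpairsPdep; exists a, b.
Qed.

Definition linked (s t : seq code) : bool := has (perm_eq t) (moves s).

Section Ideal.
Variable k : fieldType.

Local Notation I := (global_markov_ideal K33 k).
Local Notation X t := ('X_[k, mnm_of t]).

Lemma p_decodeM c t : p_ k (decode c) * X t = X (c :: t).
Proof. by rewrite mnm_of_cons mpolyXD. Qed.

Lemma linked_ideal s t : linked s t -> I (X s - X t).
Proof.
case/hasP=> _ /movesP[a [b [c [d [sa sb cd ->]]]]] /eq_mnm_of ->.
have -> : mnm_of s = mnm_of (a :: b :: rem b (rem a s)).
  rewrite (eq_mnm_of (perm_to_rem sa)) !(mnm_of_cons a).
  by rewrite (eq_mnm_of (perm_to_rem sb)).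
rewrite -!p_decodeM !mulrA -mulrBl mulrC; apply: ideal_genMl; apply: ideal_gen_in.
exact: swap_global_markov_gen.
Qed.

Lemma path_ideal s ts : path linked s ts -> I (X s - X (last s ts)).
Proof.
elim: ts s => [|t ts IHts] s /=; first by rewrite subrr => _; apply: ideal_gen0.
case/andP=> /linked_ideal st /IHts; rewrite -[X s](subrK (X t)) -addrA.
exact: ideal_genD.
Qed.

Definition move_closed (S : seq (seq code)) : bool :=
  all (fun s => all (fun t => has (perm_eq t) S) (moves s)) S.

(** A monomial multiple of a generator is a difference of two monomials joined by a move. Moves are
    reversible, so both or neither lie in the class, and their contributions cancel. *)
Lemma move_closed_coef_sum S f : move_closed S -> I f ->
  coef_sum [seq mnm_of s | s <- S] f = 0.
Proof.
move=> clS; apply: coef_sum_ideal_gen => m _ /swap_of_global_markov_gen[a [b [c [d [cd ->]]]]].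
pose U x := (U_(enum_rank (decode x)))%MM.
have sub a' b' c' d' : (c', d') \in swaps a' b' ->
    (m + (U a' + U b'))%MM \in map mnm_of S -> (m + (U c' + U d'))%MM \in map mnm_of S.
  move=> cd' /mapP[t tS]; rewrite (addmC (U a')) addmA.
  move=> /mnm_of_rem[ta /mnm_of_rem[tb ->]].
  have /hasP[t' t'S /eq_mnm_of perm_t'] : has (perm_eq (c' :: d' :: rem b' (rem a' t))) S.
    by move/allP/(_ t tS)/allP: clS; apply; apply/movesP; exists a', b', c', d'.
  apply/mapP; exists t' => //; rewrite -perm_t' !mnm_of_cons.
  by rewrite addmC -addmA.
rewrite mulrBr coef_sumB /p_ -!mpolyXD !coef_sumX.
apply/eqP; rewrite subr_eq0; apply/eqP; congr (nat_of_bool _)%:R.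
apply/idP/idP; apply: sub => //; exact: swaps_sym.
Qed.

End Ideal.

(** * The explicit monomials and the conclusion *)

(* Least significant bit first: bit i of x is the value at i, that of y at 3 + i. *)
Definition octal (x y : nat) : code :=
  ((odd x, odd x./2, odd x./2./2), (odd y, odd y./2, odd y./2./2)).

Definition monomial (s : seq (nat * nat)) : seq code := [seq octal e.1 e.2 | e <- s].

Definition mono_u := monomial [:: (0, 0); (1, 6); (2, 5); (4, 3); (7, 0)]%N.
Definition mono_v := monomial [:: (0, 0); (0, 7); (3, 4); (5, 2); (6, 1)]%N.

(** From [mono_u], 00 and 70 can become x0 and y0 with x and y complementary; then 10, 20 or 40 can
    be exchanged with 16, 25 or 43 respectively. *)
Definition class_u : seq (seq code) := map monomial
  [:: [:: (0, 0); (1, 6); (2, 5); (4, 3); (7, 0)];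
      [:: (1, 0); (1, 6); (2, 5); (4, 3); (6, 0)];
      [:: (1, 2); (1, 4); (2, 5); (4, 3); (6, 0)];
      [:: (1, 6); (2, 0); (2, 5); (4, 3); (5, 0)];
      [:: (1, 6); (2, 1); (2, 4); (4, 3); (5, 0)];
      [:: (1, 6); (2, 5); (3, 0); (4, 0); (4, 3)];
      [:: (1, 6); (2, 5); (3, 0); (4, 1); (4, 2)]]%N.

(** The additional factor 00 enters in the second exchange, with 50; the last exchange restores
    it. *)
Definition route : seq (seq code) := map monomial
  [:: [:: (0, 0); (1, 6); (2, 0); (2, 5); (4, 3); (5, 0)];
      [:: (1, 0); (1, 6); (2, 0); (2, 5); (4, 0); (4, 3)];
      [:: (1, 2); (1, 4); (2, 0); (2, 5); (4, 0); (4, 3)];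
      [:: (1, 2); (1, 4); (2, 1); (2, 4); (4, 0); (4, 3)];
      [:: (0, 4); (1, 2); (2, 1); (3, 4); (4, 0); (4, 3)];
      [:: (0, 4); (1, 2); (2, 1); (3, 4); (4, 1); (4, 2)];
      [:: (0, 2); (0, 4); (2, 1); (3, 4); (4, 1); (5, 2)];
      [:: (0, 0); (0, 6); (2, 1); (3, 4); (4, 1); (5, 2)];
      [:: (0, 0); (0, 1); (0, 6); (3, 4); (5, 2); (6, 1)];
      [:: (0, 0); (0, 0); (0, 7); (3, 4); (5, 2); (6, 1)]]%N.

Lemma route_linked : path linked (octal 0 0 :: mono_u) route.
Proof. by vm_compute. Qed.

Lemma class_u_closed : move_closed class_u.
Proof. by vm_compute. Qed.

Theorem mainTheorem5 (k : fieldType) :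
  ~ is_radical (global_markov_ideal K33 k).
Proof.
set p00 := p_ k (decode (octal 0 0)) => radI.
pose f : {mpoly k[#|state 'I_6|]} := 'X_[mnm_of mono_u] - 'X_[mnm_of mono_v].
have p00f : global_markov_ideal K33 k (p00 * f).
  have := path_ideal k route_linked.
  (* The last entry of [route] computes to [octal 0 0 :: mono_v]. *)
  by rewrite mulrBr !p_decodeM.
have If : global_markov_ideal K33 k f.
  apply/radI; exists 2%N; split=> //; rewrite expr2.
  (* Only one factor of the square is divided by [p00], giving [f ^+ 2] as a multiple of
     [p00 * f]. *)
  have {1}-> : f = p00 * ('X_[mnm_of (behead mono_u)] - 'X_[mnm_of (behead mono_v)]).
    by rewrite mulrBr !p_decodeM.
  by rewrite mulrAC mulrC; apply: ideal_genMl.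
have := move_closed_coef_sum class_u_closed If.
rewrite coef_sumB !coef_sumX mem_head.
(* With u in the class and v outside it, the form has value 1 on [f], not 0. *)
suff -> : mnm_of mono_v \in map mnm_of class_u = false by move/eqP; rewrite subr0 oner_eq0.
apply/negP=> /mapP[s sC /mnm_of_perm].
by apply/negP; move: s sC; apply/allP; vm_compute.
Qed.
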